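(* Let $\mathcal{S}$ be a semi-ring of subsets of a set $\Omega$, $\mathcal{R}$ the ring generated by $\mathcal{S}$, and $\mu$ a signed charge on $\mathcal{S}$, extended to $\mathcal{R}$. Let $A\in\mathcal{R}$. If either $\mu^+(A)<\infty$ or $\mu^-(A)<\infty$, then for every $\varepsilon>0$ there exists an $\varepsilon$-Hahn decomposition for $\mu$ on $A$. Otherwise (that is, if $\mu^+(A)=\mu^-(A)=\infty$), there exists $\varepsilon>0$ such that no $\varepsilon$-Hahn decomposition exists for $\mu$ on $A$.
   Context: A semi-ring $\mathcal{S}$ of subsets of $\Omega$ is a family with $\emptyset\in\mathcal{S}$, closed under finite intersections, and such that for $A,B\in\mathcal{S}$ the set $A\setminus B$ is a finite disjoint union of elements of $\mathcal{S}$. The ring $\mathcal{R}$ generated by $\mathcal{S}$ consists of all finite (equivalently, finite disjoint) unions of elements of $\mathcal{S}$. A signed charge on $\mathcal{S}$ (or on $\mathcal{R}$) is a set function with values in $[-\infty,\infty]$, vanishing at $\emptyset$, avoiding at least one of the values $+\infty,-\infty$, and finitely additive (for finite families of pairwise disjoint elements whose union is in the family). A signed charge $\mu$ on $\mathcal{S}$ extends uniquely to a signed charge on $\mathcal{R}$ by $\mu(\bigcup_{i=1}^nA_i):=\sum_{i=1}^n\mu(A_i)$ for pairwise disjoint $A_1,\dots,A_n\in\mathcal{S}$; the extension is denoted by the same letter. For $A\in\mathcal{R}$, $\mu^+(A):=\sup_\Pi\sum_{C\in\Pi}\max\{\mu(C),0\}$ and $\mu^-(A):=\sup_\Pi\sum_{C\in\Pi}\max\{-\mu(C),0\}$,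 where $\Pi$ ranges over all finite partitions of $A$ by elements of $\mathcal{R}$. For $\varepsilon>0$, a partition $\{H,A\setminus H\}$ of $A\in\mathcal{R}$, where $H\in\mathcal{R}$ ($H$ or $A\setminus H$ may be empty), is called an $\varepsilon$-Hahn decomposition for $\mu$ on $A$ if $\mu(B)\le\varepsilon$ for every $B\in\mathcal{R}$ with $B\subseteq H$, and $\mu(D)\ge-\varepsilon$ for every $D\in\mathcal{R}$ with $D\subseteq A\setminus H$. *)

(* Defs.v *)
From mathcomp Require Import all_boot all_order all_algebra.
From mathcomp Require Import all_classical all_reals all_analysis.

Set Implicit Arguments.
Unset Strict Implicit.
Unset Printing Implicit Defensive.

Import Order.TTheory GRing.Theory Num.Theory.

Local Open Scope classical_set_scope.
Local Open Scope ring_scope.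
Local Open Scope ereal_scope.

(* Set systems are plain predicates on [set T], for an arbitrary [T : Type]:
   the structure [semiRingOfSetsType] would force the ground set to be
   nonempty. The ring generated by [S] is the library's [<<r S>>]. *)

Definition semiring_of_sets (T : Type) (S : set (set T)) : Prop :=
  [/\ S set0, setI_closed S & semi_setD_closed S].

Definition finite_disjoint (T : Type) (C B : set (set T)) : Prop :=
  [/\ finite_set B, B `<=` C & trivIset B id].

(* Set functions are total; only the values on [C] are constrained. *)
Definition signed_charge (T : Type) (R : realType) (C : set (set T))
    (mu : set T -> \bar R) : Prop :=
  [/\ mu set0 = 0,
      (forall A, C A -> mu A <> +oo) \/ (forall A, C A -> mu A <> -oo) &
      forall B, finite_disjoint C B -> C (\bigcup_(X in B) X) ->
        mu (\bigcup_(X in B) X) = \sum_(X \in B) mu X].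

(* A chosen decomposition of [A]; junk if [A] is not a finite disjoint union
   of elements of [S]. *)
Definition decomposition (T : Type) (S : set (set T)) (A : set T) :
    set (set T) :=
  get [set B | finite_disjoint S B /\ \bigcup_(X in B) X = A].

Definition ring_extension (T : Type) (R : realType) (S : set (set T))
    (mu : set T -> \bar R) (A : set T) : \bar R :=
  \sum_(X \in decomposition S A) mu X.

Definition finite_partition (T : Type) (C : set (set T)) (A : set T)
    (P : set (set T)) : Prop :=
  [/\ finite_set P, P `<=` C & partition P id A].

Definition positive_variation (T : Type) (R : realType) (C : set (set T))
    (nu : set T -> \bar R) (A : set T) : \bar R :=
  ereal_sup [set \sum_(X \in P) maxe (nu X) 0 | P in finite_partition C A].

Definition negative_variation (T : Type) (R : realType) (C : set (set T))
    (nu : set T -> \bar R) (A : set T) : \bar R :=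
  ereal_sup [set \sum_(X \in P) maxe (- nu X) 0 | P in finite_partition C A].

(* The partition of [A] is [{H, A `\` H}]; [nu] is almost nonpositive on [H]
   and almost nonnegative on [A `\` H]. *)
Definition eps_hahn_decomposition (T : Type) (R : realType)
    (C : set (set T)) (nu : set T -> \bar R) (eps : R) (A H : set T) : Prop :=
  [/\ C H, H `<=` A,
      forall B, C B -> B `<=` H -> nu B <= eps%:E &
      forall D, C D -> D `<=` A `\` H -> (- eps)%:E <= nu D].

(* [ring_extension] does not depend on the chosen decomposition. *)
Lemma ring_extensionE (T : Type) (R : realType) (S : set (set T))
    (mu : set T -> \bar R) (B : set (set T)) :
  semiring_of_sets S -> signed_charge S mu -> finite_disjoint S B ->
  ring_extension S mu (\bigcup_(X in B) X) = \sum_(X \in B) mu X.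
Proof.
move=> [S0 SI _] [mu0 _ muU] fdB; have [Bfin BS Btriv] := fdB.
rewrite /ring_extension; set E := decomposition _ _.
have [[Efin ES Etriv] EB] : finite_disjoint S E /\
    \bigcup_(X in E) X = \bigcup_(X in B) X.
  by rewrite /E /decomposition; case: xgetP => [? -> []//|/(_ B)[]].
have refine (C D : set (set T)) : finite_disjoint S C -> finite_disjoint S D ->
    \bigcup_(X in C) X `<=` \bigcup_(X in D) X ->
    \sum_(X \in C) mu X = \sum_(X \in C) \sum_(Y \in D) mu (X `&` Y).
  move=> [_ CS _] [Dfin DS Dtriv] CD; apply: eq_fsbigr => X /set_mem XC.
  pose D' := D `&` [set Y | X `&` Y !=set0].
  have D'D : D' `<=` D by exact: subIsetl.
  have XE : X = \bigcup_(Z in [set X `&` Y | Y in D']) Z.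
    rewrite bigcup_image; apply/seteqP; split=> [x Xx|x [Y _ []]//].
    have [Y DY Yx] := CD x (ex_intro2 _ _ X XC Xx).
    by exists Y => //; split=> //; exists x.
  rewrite -(@fsbig_widen _ _ _ _ D')//; last first.
    move=> Y [DY D'Y] /=; suff -> : X `&` Y = set0 by [].
    by apply: contrapT => /eqP/set0P XY0; apply: D'Y.
  rewrite -(@fsbig_image _ _ _ _ _ D' (setI X) mu); last first.
    move=> Y Z /set_mem[DY [x [Xx Yx]]] /set_mem[DZ _] XYZ.
    apply: Dtriv => //; exists x; split => //.
    by have [] : (X `&` Z) x by rewrite -XYZ.
  rewrite {1}XE muU//; last by rewrite -XE; exact: CS.
  split.
  - by apply: finite_image; exact: sub_finite_set Dfin.
  - by move=> _ [Y [DY _] <-]; apply: SI; [exact: CS|exact: DS].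
  - move=> _ _ [Y [DY _] <-] [Z [DZ _] <-] [x [[_ Yx] [_ Zx]]].
    by rewrite (Dtriv Y Z)//; exists x.
rewrite (refine E B)// ?EB// (refine B E)// ?EB// exchange_fsbig//.
by apply: eq_fsbigr => X _; apply: eq_fsbigr => Y _; rewrite setIC.
Qed.

(* Main.v *)
Require Import Defs.
From mathcomp Require Import all_boot all_order all_algebra.
From mathcomp Require Import all_classical all_reals all_analysis.
From mathcomp Require Import lra.

Import Order.TTheory GRing.Theory Num.Theory.

Local Open Scope classical_set_scope.
Local Open Scope ring_scope.
Local Open Scope ereal_scope.

(** By additivity, the positive variation of a charge [nu] on a ring of sets
    is [mu^+(A) = sup { nu B | B in the ring, B included in A }]
    ([positive_variationE]): the positive cells of a partition can be merged
    into a single set. The whole statement follows from this formula.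

    If [mu^+(A)] is finite, choose [P] inside [A] with
    [nu P > mu^+(A) - eps] ([exists_almost_maximal]). A subset [D] of [P] has
    [nu D >= -eps], since otherwise [P `\` D] would beat the supremum; a
    subset [B] of [A `\` P] has [nu B <= eps], since otherwise [B `|` P] would.
    Hence [A `\` P] is the nonpositive part of an [eps]-Hahn decomposition.
    If [mu^-(A)] is finite, apply this to [- nu], whose positive variation is
    the negative variation of [nu], and exchange the two parts.

    Conversely, a signed charge omits one of the infinite values. If it omits
    [+oo] and [{H, A `\` H}] is an [eps]-Hahn decomposition, every [B] inside
    [A] has [nu B <= 2 eps + nu (A `\` H)], so [mu^+(A)] is finite
    ([eps_hahn_variation_lty]); if it omits [-oo], the same bound for [- nu]
    makes [mu^-(A)] finite. So when both variations are infinite, there is no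
    [eps]-Hahn decomposition for any [eps] at all, and [eps = 1] will do.

    These arguments take place in a ring on which [nu] is a signed charge.
    That the extension of [mu] is one ([signed_charge_ring_extension]) rests
    on the fact that the ring generated by a semi-ring consists of the finite
    disjoint unions of its elements ([setring_decomposition]). *)

(** * The ring generated by a semi-ring *)

Definition finite_disjoint_union {T : Type} (C : set (set T)) (A : set T) :=
  exists2 B, finite_disjoint C B & \bigcup_(X in B) X = A.

Lemma decompositionP {T : Type} {C : set (set T)} {A : set T} :
  finite_disjoint_union C A ->
  finite_disjoint C (decomposition C A) /\
    \bigcup_(X in decomposition C A) X = A.
Proof.
move=> [B fdB BA]; rewrite /decomposition.
by case: xgetP => [? -> []//|/(_ B)[]].
Qed.

(** The families [E] and [F] may share the empty set, which does not affect
    [trivIset]: it only constrains cells that meet. *)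
Lemma finite_disjointU {T : Type} {C E F : set (set T)} :
  finite_disjoint C E -> finite_disjoint C F ->
  (\bigcup_(X in E) X) `&` (\bigcup_(X in F) X) = set0 ->
  finite_disjoint C (E `|` F).
Proof.
move=> [Efin EC Etriv] [Ffin FC Ftriv] EF0.
have dis X Y z : E X -> F Y -> X z -> Y z -> False.
  by move=> EX FY Xz Yz; suff: set0 z by []; rewrite -EF0; split;
    [exists X|exists Y].
split; first by rewrite finite_setU.
- by move=> X [/EC|/FC].
- move=> X Y [EX|FX] [EY|FY] [z [/= Xz Yz]].
  + by apply: Etriv => //; exists z.
  + by case: (dis _ _ _ EX FY Xz Yz).
  + by case: (dis _ _ _ EY FX Yz Xz).
  + by apply: Ftriv => //; exists z.
Qed.

Lemma finite_disjoint_unionU {T : Type} {C : set (set T)} {A B : set T} :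
  finite_disjoint_union C A -> finite_disjoint_union C B ->
  A `&` B = set0 -> finite_disjoint_union C (A `|` B).
Proof.
move=> [E fdE <-] [F fdF <-] EF0; exists (E `|` F).
  exact: finite_disjointU.
by rewrite bigcup_setU.
Qed.

Section semiring.
Context {T : Type} {S : set (set T)}.
Hypothesis semiS : semiring_of_sets S.

(** Removing [B] from each cell of a decomposition of [A] leaves a finite
    disjoint union of elements of [S]; the union of these decompositions
    decomposes [A `\` B]. *)
Lemma finite_disjoint_unionD1 (A B : set T) :
  finite_disjoint_union S A -> S B -> finite_disjoint_union S (A `\` B).
Proof.
have [_ _ SD] := semiS.
move=> [E [Efin ES Etriv] <-] SB.
have fdD X : E X -> finite_disjoint S (decomposition S (X `\` B)) /\
    \bigcup_(Y in decomposition S (X `\` B)) Y = X `\` B.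
  move=> EX; apply: decompositionP; have [D [? ? ? ?]] := SD X B (ES _ EX) SB.
  by exists D.
exists (\bigcup_(X in E) decomposition S (X `\` B)).
  split.
  - by apply: bigcup_finite => // X /fdD[[]].
  - by move=> Y [X /fdD[[_ DS _] _] DY]; exact: DS.
  - move=> Y Y' [X EX DY] [X' EX' DY'] [z [/= Yz Y'z]].
    have sub W Z : E W -> decomposition S (W `\` B) Z -> Z z -> W z.
      move=> EW DZ Zz; suff : (W `\` B) z by case.
      by rewrite -(fdD _ EW).2; exists Z.
    have XX' : X = X'.
      by apply: Etriv => //; exists z; split; [exact: sub DY _|exact: sub DY' _].
    rewrite -XX' in DY'; have [[_ _ Dtriv] _] := fdD X EX.
    by apply: Dtriv => //; exists z.
rewrite bigcup_bigcup setD_bigcupl.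
by apply: eq_bigcupr => X EX; rewrite (fdD X EX).2.
Qed.

(** Differences are obtained by removing the cells of the second set one by
    one; a union is then the disjoint union of [A `\` B] and [B]. *)
Lemma setring_finite_disjoint_union : setring (finite_disjoint_union S).
Proof.
have dD : setD_closed (finite_disjoint_union S).
  move=> A _ dA [F [/finite_seqP[s ->] FS _] <-].
  elim: s FS => [|B s IHs] FS.
    by rewrite bigcup_seq big_nil setD0.
  have -> : A `\` \bigcup_(X in [set` B :: s]) X
      = (A `\` \bigcup_(X in [set` s]) X) `\` B.
    by rewrite !bigcup_seq big_cons setDDl setUC.
  apply: finite_disjoint_unionD1.
    by apply: IHs => X /= Xs; apply: FS => /=; rewrite inE Xs orbT.
  by apply: FS; exact: mem_head.
split => //.
  by exists set0; [split=> // ? ? []|rewrite bigcup_set0].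
move=> A B dA dB; rewrite -[A `|` B](setDKU (@subsetUr _ A B)) setDUD setDv setU0.
by apply: finite_disjoint_unionU => //; [exact: dD|exact: setDKI].
Qed.

Lemma setring_decomposition A : <<r S >> A -> finite_disjoint_union S A.
Proof.
apply: smallest_sub; first exact: setring_finite_disjoint_union.
move=> X SX; exists [set X]; last by rewrite bigcup_set1.
by split=> [|Y ->|Y Z -> ->].
Qed.

End semiring.

(** * Signed charges on rings *)

Lemma finite_set_uniq_seq {T : choiceType} {B : set T} :
  finite_set B -> exists2 s : seq T, uniq s & B = [set` s].
Proof.
move=> /finite_seqP[s ->]; exists (undup s); first exact: undup_uniq.
by apply/seteqP; split=> x /=; rewrite mem_undup.
Qed.

(** On a ring, additivity for two disjoint sets is enough, because the partial
    unions of a finite disjoint family stay in the ring. *)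
Lemma additive_signed_charge {T : Type} {R : realType} {C : set (set T)}
    {nu : set T -> \bar R} :
  setring C -> nu set0 = 0 ->
  (forall A, C A -> nu A <> +oo) \/ (forall A, C A -> nu A <> -oo) ->
  (forall A B, C A -> C B -> A `&` B = set0 -> nu (A `|` B) = nu A + nu B) ->
  signed_charge C nu.
Proof.
move=> [C0 CU CD] nu0 nuoo nuU; split=> // B [/finite_set_uniq_seq[s us ->]].
move=> sC striv _; rewrite bigcup_seq -fsbig_seq//.
suff [] : C (\big[setU/set0]_(X <- s) X) /\
  nu (\big[setU/set0]_(X <- s) X) = \sum_(X <- s) nu X by [].
elim: s us sC striv => [_ _ _|X s IHs /andP[Xs us] sC striv].
  by rewrite !big_nil.
have sub : [set` s] `<=` [set` X :: s] by move=> Y /= Ys; rewrite inE Ys orbT.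
have CX : C X by apply: sC; exact: mem_head.
have [||Cs nus] := IHs us; first exact: subset_trans sC.
  exact: sub_trivIset striv.
rewrite !big_cons; split; first exact: CU.
rewrite nuU ?nus// -bigcup_seq; apply/seteqP; split => // x [Xx [Y /= Ys Yx]].
have XY : X = Y.
  by apply: striv; [exact: mem_head|exact: sub|exists x].
by rewrite XY Ys in Xs.
Qed.

Lemma signed_chargeU {T : Type} {R : realType} {C : set (set T)}
    {nu : set T -> \bar R} {A B : set T} :
  setring C -> signed_charge C nu -> C A -> C B -> A `&` B = set0 ->
  nu (A `|` B) = nu A + nu B.
Proof.
move=> [_ CU _] [nu0 _ nuU] CA CB AB0.
have := nuU ([set A] `|` [set B]).
rewrite bigcup_setU !bigcup_set1 fsbigU//; last first.
  by move=> _ [/= -> AB]; move: AB0; rewrite AB setIid => ->.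
rewrite !fsbig_set1; apply; last exact: CU.
apply: finite_disjointU; rewrite ?bigcup_set1//.
- by split=> [|Y ->|Y Z -> ->].
- by split=> [|Y ->|Y Z -> ->].
Qed.

(** The negative variation of [nu] is by definition the positive variation of
    its opposite, so this lemma halves the work. *)
Lemma signed_chargeN {T : Type} {R : realType} {C : set (set T)}
    {nu : set T -> \bar R} :
  signed_charge C nu -> signed_charge C (fun X => - nu X).
Proof.
move=> [nu0 nuoo nuU]; split.
- by rewrite nu0 oppe0.
- by case: nuoo => nuoo; [right|left] => A /nuoo; case: (nu A).
- move=> B fdB CB; rewrite nuU//; have [Bfin BC _] := fdB.
  have [s us sB] := finite_set_uniq_seq Bfin.
  rewrite sB -!fsbig_seq// !big_seq sumeN// => X Y Xs Ys.
  have CX : C X by apply: BC; rewrite sB.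
  have CY : C Y by apply: BC; rewrite sB.
  case: nuoo => nuoo; move: (nuoo X CX) (nuoo Y CY);
    by case: (nu X) => [x| |]; case: (nu Y).
Qed.

(** * Variations and Hahn decompositions *)

Section setring_charge.
Context {T : Type} {R : realType} {C : set (set T)} {nu : set T -> \bar R}.
Hypotheses (ringC : setring C) (nuC : signed_charge C nu).

(** For a partition of [A], the sum of the positive parts is the charge of the
    union of the cells of nonnegative charge; conversely, a nonempty
    subset [B] is a cell of the partition [{B, A `\` B}], and [nu set0 = 0] is
    below every sum of positive parts. *)
Lemma positive_variationE (A : set T) : C A ->
  positive_variation C nu A
  = ereal_sup [set nu B | B in [set B | C B /\ B `<=` A]].
Proof.
have [C0 CU CD] := ringC; have [nu0 _ nuU] := nuC.
move=> CA; apply/eqP; rewrite eq_le; apply/andP; split.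
- apply: ge_ereal_sup => _ [P [Pfin PC [PA Ptriv P0]] <-].
  pose Q := P `&` [set X | 0 <= nu X].
  have QP : Q `<=` P by exact: subIsetl.
  have fdQ : finite_disjoint C Q.
    split.
    - exact: sub_finite_set QP Pfin.
    - by move=> X [/PC].
    - exact: sub_trivIset QP Ptriv.
  have CQ : C (\bigcup_(X in Q) X).
    have [Qfin QC _] := fdQ.
    by rewrite -(setring_id ringC); apply: setring_fin_bigcup => // X /QC CX; rewrite setring_id.
  rewrite [leLHS](_ : _ = nu (\bigcup_(X in Q) X)).
    apply: ereal_sup_ubound; exists (\bigcup_(X in Q) X) => //; split=> // x [X [PX _] Xx].
    by rewrite -PA; exists X.
  rewrite nuU// /Q fsbig_mkcondr; apply: eq_fsbigr => X _.
  case: ifPn; rewrite ?notin_setE ?inE /=; first exact: max_l.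
  by move=> /negP; rewrite -ltNge => /ltW; exact: max_r.
- apply: ge_ereal_sup => _ [B [CB BA] <-].
  (* The cells of a partition are nonempty, hence the removal of [set0]. *)
  pose P := [set B; A `\` B] `\ set0.
  have Pfin : finite_set P by apply: finite_setD; rewrite finite_setU.
  apply: (@le_trans _ _ (\sum_(X \in P) maxe (nu X) 0)); last first.
    apply: ereal_sup_ubound; exists P => //; split => //.
    + by move=> X [[->//|->] _]; exact: CD.
    split.
    + apply/seteqP; split => [x [X [[->|->] _]]|x Ax]/=; [exact: BA|by case|].
      have [Bx|nBx] := pselect (B x).
        by exists B => //; split; [left|move=> B0; rewrite B0 in Bx].
      exists (A `\` B) => //; split; first by right.
      by move=> /= AB0; suff : set0 x by []; rewrite -AB0.
    + by move=> X Y [[->|->] _] [[->|->] _]// [x [/= +]] => [? []|[]].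
    + by move=> X [_ /= /eqP/set0P].
  have sum_ge0 Q : 0 <= \sum_(X \in Q) maxe (nu X) 0.
    by apply: fsume_ge0 => X _; rewrite le_max lexx orbT.
  have [->|/eqP B0] := eqVneq B set0; first by rewrite nu0.
  rewrite (fsbigD1 B)//; last by split; [left|].
  by rewrite -[leLHS]adde0 leeD// le_max lexx.
Qed.

(** [P] is a subset of [A] whose charge comes within [eps] of the supremum
    defining the positive variation. *)
Lemma exists_almost_maximal {A : set T} {eps : R} : C A ->
  positive_variation C nu A < +oo -> (0 < eps)%R ->
  exists P, [/\ C P, P `<=` A,
    forall D, C D -> D `<=` P -> (- eps)%:E <= nu D &
    forall B, C B -> B `<=` A `\` P -> nu B <= eps%:E].
Proof.
move=> CA; rewrite positive_variationE//; set s := ereal_sup _ => s_lt eps0.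
have [C0 CU CD] := ringC; have [nu0 _ _] := nuC.
have s_ub B : C B -> B `<=` A -> nu B <= s.
  by move=> CB BA; apply: ereal_sup_ubound; exists B.
have s_fin : s \is a fin_num.
  rewrite ge0_fin_numE//; have := s_ub _ C0 (@sub0set _ _).
  by rewrite nu0.
have [_ [P [CP PA] <-] sP] := ub_ereal_sup_adherent eps0 s_fin.
exists P; split => //.
- move=> D CD' DP.
  have := s_ub (P `\` D) (CD _ _ CP CD') (subset_trans (@subDsetl _ _ _) PA).
  have := signed_chargeU ringC nuC CD' (CD _ _ CP CD') (setDIK _ _).
  rewrite setDUK// => nuP; rewrite nuP -/s in sP; move: sP {nuP}.
  move: s s_fin {s_lt s_ub} => [s| |]// _.
  case: (nu D) => [d| |]; case: (nu (P `\` D)) => [q| |] //=;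
    rewrite ?leey -?EFinD -?EFinB ?lte_fin ?lee_fin//; lra.
- move=> B CB BAP.
  have BP0 : B `&` P = set0.
    by apply/seteqP; split=> // x [/BAP[]].
  have BPA : B `|` P `<=` A by move=> x [/BAP[]|/PA].
  have := s_ub _ (CU _ _ CB CP) BPA.
  rewrite (signed_chargeU ringC nuC CB CP BP0).
  rewrite -/s in sP; move: sP.
  move: s s_fin {s_lt s_ub} => [s| |]// _.
  case: (nu B) => [b| |]; case: (nu P) => [p| |] //=;
    rewrite ?leNye -?EFinD -?EFinB ?lte_fin ?lee_fin//; lra.
Qed.

(** For [B] inside [A], the part of [B] in [H] has charge at most [eps], and
    the part outside [H] exceeds [nu (A `\` H)] by at most [eps], since what it
    leaves of [A `\` H] has charge at least [- eps]. *)
Lemma eps_hahn_variation_lty {A H : set T} {eps : R} : C A ->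
  (forall X, C X -> nu X <> +oo) -> eps_hahn_decomposition C nu eps A H ->
  positive_variation C nu A < +oo.
Proof.
move=> CA nu_lty [CH HA Hle Dge].
have [C0 CU CD] := ringC.
have CP : C (A `\` H) by exact: CD.
rewrite positive_variationE//.
apply: (@le_lt_trans _ _ (eps%:E + (eps%:E + nu (A `\` H)))); last first.
  by have := nu_lty _ CP; case: (nu _) => // r _; rewrite -!EFinD ltry.
apply: ge_ereal_sup => _ [B [CB BA] <-].
have CBH : C (B `&` H).
  by rewrite -setDD; apply: (CD) => //; exact: CD.
have CB' : C (B `\` H) by exact: CD.
have := signed_chargeU ringC nuC CBH CB' _.
rewrite setUIDK => -> //; last first.
  by apply/seteqP; split=> // x [[_ Hx] [_ /(_ Hx)]].
apply: leeD; first by apply: Hle => // x [].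
have B'P : B `\` H `<=` A `\` H by exact: setSD.
have CQ := CD _ _ CP CB'.
have := signed_chargeU ringC nuC CB' CQ (setDIK _ _).
rewrite setDUK// => ->.
have := Dge _ CQ (@subDsetl _ _ _).
have := nu_lty _ CB'; have := nu_lty _ CQ.
by case: (nu (B `\` H)) => [b| |]; case: (nu _) => [q| |]//= _ _;
  rewrite ?leNye -?EFinD ?lee_fin//; lra.
Qed.

End setring_charge.

(** Merging decompositions of two disjoint sets gives one of their union. Their
    only possible common cell is the empty set, which contributes nothing. An
    infinite value omitted on [S] is also omitted by finite sums. *)
Lemma signed_charge_ring_extension {T : Type} {R : realType} {S : set (set T)}
    {mu : set T -> \bar R} :
  semiring_of_sets S -> signed_charge S mu ->
  signed_charge <<r S >> (ring_extension S mu).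
Proof.
move=> semiS muS; have [mu0 muoo _] := muS.
have S0 : finite_disjoint S set0 by split=> // ? ? [].
apply: additive_signed_charge.
- exact: smallest_setring.
- by rewrite -(bigcup_set0 id) ring_extensionE// fsbig_set0.
- have sum_neq (z : \bar R) A : (forall x y, x <> z -> y <> z -> x + y <> z) ->
      0 <> z -> (forall A, S A -> mu A <> z) -> <<r S >> A ->
      ring_extension S mu A <> z.
    move=> zD z0 muz /(setring_decomposition semiS)[B fdB <-].
    rewrite ring_extensionE//; have [Bfin BS _] := fdB.
    have [s us sB] := finite_set_uniq_seq Bfin.
    rewrite sB -fsbig_seq// big_seq; apply: (big_ind (fun x => x <> z)) => // X Xs.
    by apply/muz/BS; rewrite sB.
  case: muoo => muz; [left|right] => A SA; apply: sum_neq => //.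
    by move=> [x| |] [y| |].
  by move=> [x| |] [y| |].
- move=> A B /(setring_decomposition semiS)[E fdE <-].
  move=> /(setring_decomposition semiS)[F fdF <-] EF0.
  rewrite -bigcup_setU !ring_extensionE//; last exact: finite_disjointU.
  have [Efin ES _] := fdE; have [Ffin FS _] := fdF.
  rewrite fsbigU// => X [EX FX] /=.
  have -> : X = set0.
    by apply/seteqP; split=> // x Xx; rewrite -EF0; split; exists X.
  exact: mu0.
Qed.

Lemma eps_hahn_decompositionN {T : Type} {R : realType} {C : set (set T)}
    {nu : set T -> \bar R} {eps : R} {A H : set T} : setring C -> C A ->
  eps_hahn_decomposition C nu eps A H ->
  eps_hahn_decomposition C (fun X => - nu X) eps A (A `\` H).
Proof.
move=> [_ _ CD] CA [CH HA Hle Dge]; split=> //; first exact: CD.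
- by move=> B CB /Dge-/(_ CB); rewrite EFinN leeNl.
- move=> D CD'; rewrite setDD setIidr// => /Hle-/(_ CD').
  by rewrite EFinN leeN2.
Qed.

Theorem theorem7p3 (R : realType) (T : Type) (S : set (set T))
    (mu : set T -> \bar R) (A : set T) :
  semiring_of_sets S -> signed_charge S mu -> <<r S >> A ->
  let nu := ring_extension S mu in
  (positive_variation <<r S >> nu A < +oo \/
   negative_variation <<r S >> nu A < +oo ->
   forall eps : R, (0 < eps)%R ->
     exists H, eps_hahn_decomposition <<r S >> nu eps A H) /\
  (positive_variation <<r S >> nu A = +oo /\
   negative_variation <<r S >> nu A = +oo ->
   exists eps : R, (0 < eps)%R /\
     ~ exists H, eps_hahn_decomposition <<r S >> nu eps A H).
Proof.
move=> semiS muS SA nu.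
have ringR : setring <<r S >> by exact: smallest_setring.
have nuR : signed_charge <<r S >> nu by exact: signed_charge_ring_extension.
have nuNR := signed_chargeN nuR.
split.
- move=> vlty eps eps0; case: vlty => vlty.
    have [P [CP PA Pge Ple]] := exists_almost_maximal ringR nuR SA vlty eps0.
    exists (A `\` P); split => //; first exact: setringD.
    by move=> D CD; rewrite setDD setIidr//; exact: Pge.
  have [P [CP PA Pge Ple]] := exists_almost_maximal ringR nuNR SA vlty eps0.
  exists P; split => //.
    by move=> B CB /(Pge _ CB); rewrite EFinN leeN2.
  by move=> D CD /(Ple _ CD); rewrite EFinN leeNl.
- move=> [pvy nvy]; exists 1%R; split=> // -[H hahnH].
  have [_ [nuoo|nuoo] _] := nuR.
    have := eps_hahn_variation_lty ringR nuR SA nuoo hahnH.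
    by rewrite pvy ltxx.
  have nuNoo X : <<r S >> X -> - nu X <> +oo.
    by move=> /nuoo; case: (nu X).
  have := eps_hahn_variation_lty ringR nuNR SA nuNoo
    (eps_hahn_decompositionN ringR SA hahnH).
  by rewrite [ltLHS]nvy ltxx.
Qed.
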